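(* Let $n$ be a positive integer, let $P\in\mathbb{C}^{n\times n}$ be a projection and let $Q\in\mathbb{C}^{n\times n}$ be an idempotent such that $PQ=Q$. Then $$\|P-Q\|_F\ge \lambda_{P,Q},\qquad\text{where}\quad \lambda_{P,Q}=\sqrt{\|m(Q)-Q\|_F^2+\mathrm{rank}(P)-\mathrm{rank}(Q)}$$ and $m(Q)$ is the matched projection of $Q$. Moreover, equality $\|P-Q\|_F=\lambda_{P,Q}$ occurs if and only if $Q$ is a projection.
   Context: An idempotent is a matrix $Q$ with $Q^2=Q$; a projection is a Hermitian idempotent ($P=P^*=P^2$). $\|\cdot\|_F$ is the Frobenius norm, $A^*$ the conjugate transpose, $A^\dag$ the Moore-Penrose inverse, and $|A|=(A^*A)^{1/2}$ the positive semi-definite square root, so $|Q^*|=(QQ^* )^{1/2}$. For an idempotent $Q\in\mathbb{C}^{n\times n}$ the matched projection is $$m(Q)=\tfrac12\big(|Q^*|+Q^*\big)\,|Q^*|^\dag\,\big(|Q^*|+I_n\big)^{-1}\big(|Q^*|+Q\big),$$ which is known to be a projection. *)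

(* Defs.v *)
From mathcomp Require Import all_boot all_order all_algebra.
From mathcomp Require Import boolp classical_sets reals complex.

Set Implicit Arguments.
Unset Strict Implicit.
Unset Printing Implicit Defensive.

Import Order.TTheory GRing.Theory Num.Theory.
Local Open Scope ring_scope.
Local Open Scope sesquilinear_scope.
Local Open Scope classical_set_scope.

Section Definitions.
Context {C : numClosedFieldType}.

Definition is_idempotent n (Q : 'M[C]_n) : Prop := Q *m Q = Q.

Definition is_projection n (P : 'M[C]_n) : Prop :=
  P ^t* = P /\ P *m P = P.

(* As usual for norms over a numClosedFieldType, the value lives in C and is
   a nonnegative real element of C. *)
Definition frobenius m n (A : 'M[C]_(m, n)) : C :=
  sqrtC (\sum_(i < m) \sum_(j < n) `|A i j| ^+ 2).

Definition psdmx n (A : 'M[C]_n) : Prop :=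
  A ^t* = A /\ forall x : 'cV[C]_n, 0 <= (x ^t* *m A *m x) 0 0.

(* The default value 0 of [xget] is never used when H is positive
   semi-definite: see [psd_sqrtmxP] and [psd_sqrtmx_unique]. *)
Definition psd_sqrtmx n (H : 'M[C]_n) : 'M[C]_n :=
  xget 0 [set B | psdmx B /\ B *m B = H].

Definition absmx m n (A : 'M[C]_(m, n)) : 'M[C]_n := psd_sqrtmx (A ^t* *m A).

Definition penrose m n (A : 'M[C]_(m, n)) (X : 'M[C]_(n, m)) : Prop :=
  [/\ A *m X *m A = A, X *m A *m X = X,
      (A *m X) ^t* = A *m X & (X *m A) ^t* = X *m A].

(* The default value 0 of [xget] is never used: see [mpinvmxP] and
   [penrose_unique]. *)
Definition mpinvmx m n (A : 'M[C]_(m, n)) : 'M[C]_(n, m) :=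
  xget 0 [set X | penrose A X].

(* [invmx] is a genuine inverse here: see [absmx_add1_unit]. *)
Definition matched_projection n (Q : 'M[C]_n) : 'M[C]_n :=
  let T := absmx (Q ^t*) in
  2^-1 *: ((T + Q ^t*) *m mpinvmx T *m invmx (T + 1%:M) *m (T + Q)).

Definition lambda n (P Q : 'M[C]_n) : C :=
  sqrtC (frobenius (matched_projection Q - Q) ^+ 2
         + (\rank P)%:R - (\rank Q)%:R).

End Definitions.

Section WellDefinedness.
Context {C : numClosedFieldType}.

Lemma trmxC_mul m n p (A : 'M[C]_(m, n)) (B : 'M[C]_(n, p)) :
  (A *m B) ^t* = B ^t* *m A ^t*.
Proof. by rewrite trmx_mul map_mxM. Qed.

Lemma mulmx_trmxC_ge0 n (x : 'cV[C]_n) : 0 <= (x ^t* *m x) 0 0.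
Proof.
rewrite mxE sumr_ge0 // => i _; rewrite !mxE mulrC; exact: mul_conjC_ge0.
Qed.

Lemma mulmx_trmxC_eq0 n (x : 'cV[C]_n) : (x ^t* *m x) 0 0 = 0 -> x = 0.
Proof.
rewrite mxE => /eqP; rewrite psumr_eq0; last first.
  by move=> i _; rewrite !mxE mulrC; exact: mul_conjC_ge0.
move=> /allP x0; apply/colP => i; apply/eqP.
have /= := x0 i (mem_index_enum i).
by rewrite !mxE mulf_eq0 conjC_eq0 orbb.
Qed.

Lemma row_free_gram_unit m n (A : 'M[C]_(m, n)) :
  row_free A -> A *m A ^t* \in unitmx.
Proof.
move=> freeA; rewrite -row_free_unit; apply/row_freeP.
have : kermx (A *m A ^t*) = 0.
  apply/row_matrixP => i; rewrite row0; set v := row i _.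
  have : v *m (A *m A ^t*) = 0.
    by apply/sub_kermxP; exact: row_sub.
  move=> v0; apply: (row_free_inj freeA); rewrite mul0mx.
  suff vA : (v *m A) ^t* = 0 by rewrite -[LHS]trmxCK vA trmx0 map_mx0.
  apply: mulmx_trmxC_eq0.
  by rewrite trmxCK trmxC_mul !mulmxA -(mulmxA v) v0 mul0mx mxE.
by move=> /eqP; rewrite kermx_eq0 => /row_freeP.
Qed.

Lemma mpinvmxP m n (A : 'M[C]_(m, n)) : penrose A (mpinvmx A).
Proof.
rewrite /mpinvmx; case: xgetP => [X _ //|no]; exfalso.
move: (esym (mulmx_base A)) (row_base_free A) (col_base_full A).
move: (col_base A) (row_base A); move: (\rank A) => r F G AE freeG fullF.
have uG : G *m G ^t* \in unitmx by exact: row_free_gram_unit.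
have uF : F ^t* *m F \in unitmx.
  rewrite -{2}[F]trmxCK; apply: row_free_gram_unit.
  by rewrite /row_free mxrank_map mxrank_tr.
have hF : (invmx (F ^t* *m F)) ^t* = invmx (F ^t* *m F).
  by rewrite trmx_inv map_invmx trmxC_mul trmxCK.
have hG : (invmx (G *m G ^t*)) ^t* = invmx (G *m G ^t*).
  by rewrite trmx_inv map_invmx trmxC_mul trmxCK.
pose K := G ^t* *m invmx (G *m G ^t*); pose L := invmx (F ^t* *m F) *m F ^t*.
have GK : G *m K = 1%:M by rewrite /K mulmxA mulmxV.
have LF : L *m F = 1%:M by rewrite /L -mulmxA mulVmx.
have AX : A *m (K *m L) = F *m L by rewrite AE mulmxA -(mulmxA F) GK mulmx1.
have XA : K *m L *m A = K *m G by rewrite AE mulmxA -(mulmxA K) LF mulmx1.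
apply: (no (K *m L)); split.
- by rewrite AX AE -mulmxA (mulmxA L) LF mul1mx.
- by rewrite XA -mulmxA (mulmxA G) GK mul1mx.
- by rewrite AX !trmxC_mul hF trmxCK mulmxA.
- by rewrite XA !trmxC_mul hG trmxCK mulmxA.
Qed.

Lemma penrose_unique m n (A : 'M[C]_(m, n)) (X Y : 'M[C]_(n, m)) :
  penrose A X -> penrose A Y -> X = Y.
Proof.
move=> [X1 X2 X3 X4] [Y1 Y2 Y3 Y4].
have AXY : A *m X = A *m Y.
  rewrite -X3 -Y3 -[in LHS]Y1 -(mulmxA (A *m Y)) trmxC_mul X3 Y3.
  by rewrite mulmxA X1.
have XAY : X *m A = Y *m A.
  rewrite -X4 -Y4 -[in LHS]Y1 -(mulmxA A) mulmxA trmxC_mul X4 Y4.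
  by rewrite -mulmxA (mulmxA A) X1.
by rewrite -X2 -mulmxA AXY mulmxA XAY.
Qed.

Lemma hermitian_diag n (H : 'M[C]_n) : H ^t* = H ->
  exists (U : 'M[C]_n) (d : 'rV[C]_n),
    [/\ U ^t* *m U = 1%:M, U *m U ^t* = 1%:M &
        H = U ^t* *m diag_mx d *m U].
Proof.
move=> hH; have nH : H \is normalmx by apply/normalmxP; rewrite hH.
have /unitarymxP UU := spectral_unitarymx H.
exists (spectralmx H), (spectral_diag H); split=> //; first exact: mulmx1C.
by rewrite -(invmx_unitary (spectral_unitarymx H)); exact/orthomx_spectralP.
Qed.

Lemma unitary_eigen n (H U : 'M[C]_n) (d : 'rV[C]_n) (i : 'I_n) :
  U *m U ^t* = 1%:M -> H = U ^t* *m diag_mx d *m U ->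
  H *m col i (U ^t*) = d 0 i *: col i (U ^t*).
Proof.
move=> UU ->; rewrite [in LHS]colE mulmxA -(mulmxA _ U) UU mulmx1 -colE.
by apply/colP => j; rewrite mxE mul_mx_diag !mxE mulrC.
Qed.

Lemma unitary_col_norm n (U : 'M[C]_n) (i : 'I_n) :
  U *m U ^t* = 1%:M -> ((col i (U ^t*)) ^t* *m col i (U ^t*)) 0 0 = 1.
Proof.
move=> /matrixP /(_ i i); rewrite [RHS]mxE eqxx /= mulr1n => UU1.
rewrite -[RHS]UU1 !mxE; apply: eq_bigr => j _.
by rewrite !mxE conjCK.
Qed.

Lemma psd_sqrtmx_unique n (B1 B2 : 'M[C]_n) :
  psdmx B1 -> psdmx B2 -> B1 *m B1 = B2 *m B2 -> B1 = B2.
Proof.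
move=> [h1 p1] [h2 p2] E; apply/eqP; rewrite -subr_eq0; apply/eqP.
set D := B1 - B2.
have hD : D ^t* = D by rewrite /D linearB /= map_mxB h1 h2.
have SD : B1 *m D + D *m B2 = 0.
  by rewrite /D mulmxBr mulmxBl E addrA subrK subrr.
have [U [d [_ UU DE]]] := hermitian_diag hD.
suff d0 : d = 0 by rewrite DE d0 linear0 mulmx0 mul0mx.
apply/rowP => i; rewrite [RHS]mxE; apply/eqP/negPn/negP => di0.
set x := col i (U ^t*).
have Dx : D *m x = d 0 i *: x by exact: unitary_eigen.
have xx : (x ^t* *m x) 0 0 = 1 by exact: unitary_col_norm.
have xD : x ^t* *m D = (d 0 i)^* *: x ^t*.
  by rewrite -{1}hD -trmxC_mul Dx linearZ /= map_mxZ.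
have dr : (d 0 i)^* = d 0 i.
  have : x ^t* *m D *m x = x ^t* *m (D *m x) by rewrite mulmxA.
  rewrite xD Dx -scalemxAl -scalemxAr => /matrixP /(_ 0 0).
  by rewrite [LHS]mxE [RHS]mxE xx !mulr1.
have : x ^t* *m (B1 *m D + D *m B2) *m x = 0 by rewrite SD mulmx0 mul0mx.
rewrite mulmxDr mulmxDl !mulmxA xD -!mulmxA Dx dr -!scalemxAl -!scalemxAr.
rewrite -scalerDr => /eqP; rewrite scaler_eq0 (negbTE di0) /=.
move=> /eqP /matrixP /(_ 0 0); rewrite [LHS]mxE [RHS]mxE !mulmxA => /eqP.
rewrite paddr_eq0// => /andP[/eqP b1 /eqP b2].
have : (x ^t* *m D *m x) 0 0 = 0.
  rewrite /D mulmxBr mulmxBl [LHS]mxE b1 add0r.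
  by rewrite [LHS]mxE b2 oppr0.
rewrite xD dr -scalemxAl mxE xx mulr1 => di.
by rewrite di eqxx in di0.
Qed.

Lemma psd_sqrtmxP n (H : 'M[C]_n) : psdmx H ->
  psdmx (psd_sqrtmx H) /\ psd_sqrtmx H *m psd_sqrtmx H = H.
Proof.
move=> [hH pH]; rewrite /psd_sqrtmx; case: xgetP => [B _ //|no]; exfalso.
have [U [d [U'U UU HE]]] := hermitian_diag hH.
have d0 i : 0 <= d 0 i.
  have := pH (col i (U ^t*)).
  by rewrite -mulmxA (unitary_eigen i UU HE) -scalemxAr mxE unitary_col_norm// mulr1.
pose s : 'rV[C]_n := \row_i sqrtC (d 0 i).
apply: (no (U ^t* *m diag_mx s *m U)); split; last first.
  rewrite !mulmxA -(mulmxA _ U) UU mulmx1 -(mulmxA (U ^t*)) mulmx_diag HE.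
  congr (_ *m diag_mx _ *m _); apply/rowP => i; rewrite !mxE.
  by rewrite -expr2 sqrtCK.
split=> [|x].
  rewrite !trmxC_mul trmxCK tr_diag_mx map_diag_mx mulmxA.
  congr (_ *m diag_mx _ *m _); apply/rowP => i; rewrite !mxE.
  by apply/CrealP/ger0_real; rewrite sqrtC_ge0.
rewrite !mulmxA -trmxC_mul -(mulmxA _ U); set y := U *m x.
rewrite mul_mx_diag mxE sumr_ge0// => i _; rewrite !mxE.
by rewrite mulrAC mulr_ge0 ?sqrtC_ge0// mulrC mul_conjC_ge0.
Qed.

Lemma absmxP m n (A : 'M[C]_(m, n)) :
  psdmx (absmx A) /\ absmx A *m absmx A = A ^t* *m A.
Proof.
apply: psd_sqrtmxP; split=> [|x]; first by rewrite trmxC_mul trmxCK.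
by rewrite mulmxA -trmxC_mul -mulmxA mulmx_trmxC_ge0.
Qed.

Lemma absmx_add1_unit m n (A : 'M[C]_(m, n)) : absmx A + 1%:M \in unitmx.
Proof.
have [[hT pT] _] := absmxP A; set T := absmx A in hT pT *.
rewrite -row_free_unit -kermx_eq0; apply/eqP/row_matrixP => i; rewrite row0.
set v := row i _.
have v0 : v *m (T + 1%:M) = 0 by apply/sub_kermxP; exact: row_sub.
suff w0 : v ^t* = 0 by rewrite -[v]trmxCK w0 trmx0 map_mx0.
apply: mulmx_trmxC_eq0.
have : (v *m (T + 1%:M) *m v ^t*) 0 0 = 0 by rewrite v0 mul0mx mxE.
rewrite mulmxDr mulmx1 mulmxDl mxE => /eqP.
rewrite paddr_eq0; first by rewrite trmxCK => /andP[_ /eqP].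
  by have := pT (v ^t*); rewrite trmxCK.
by have := mulmx_trmxC_ge0 (v ^t*); rewrite trmxCK.
Qed.

End WellDefinedness.

(* Main.v *)
(** Write T = |Q*| and E = T T^+, the orthogonal projection onto the range of Q.
  Since Q T = T and Q Q* = T^2, the matrix m(Q) is a projection of trace rank Q
  and Q m(Q) = (T + Q) / 2. Expanding squared Frobenius norms as traces gives
    |P - Q|_F^2 - lambda^2 = tr T - tr E.
  With N = Q - E one has N E = 0 and E N = N, hence T^2 = E + N N* and
  (T + 1) (T - E) = N N*; so tr T - tr E = tr (N* (T + 1)^-1 N), which is
  nonnegative and vanishes only if N = 0, i.e. Q = E. *)

Require Import Defs.
From mathcomp Require Import all_boot all_order all_algebra.
From mathcomp Require Import reals complex ring.

Import Order.TTheory GRing.Theory Num.Theory.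
Local Open Scope ring_scope.

(** * Frobenius norms, Gram matrices and traces of idempotents *)

Section FrobeniusTrace.
Local Open Scope sesquilinear_scope.
Context {C : numClosedFieldType}.

Lemma trmxCD m n (A B : 'M[C]_(m, n)) : (A + B) ^t* = A ^t* + B ^t*.
Proof. by rewrite linearD /= map_mxD. Qed.

Lemma trmxCB m n (A B : 'M[C]_(m, n)) : (A - B) ^t* = A ^t* - B ^t*.
Proof. by rewrite linearB /= map_mxB. Qed.

Lemma trmxC1 n : (1%:M : 'M[C]_n) ^t* = 1%:M.
Proof. by rewrite trmx1 map_mx1. Qed.

Lemma trmxC_invmx n (A : 'M[C]_n) : (invmx A) ^t* = invmx (A ^t*).
Proof. by rewrite trmx_inv map_invmx. Qed.

Lemma mxtraceB n (A B : 'M[C]_n) : \tr (A - B) = \tr A - \tr B.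
Proof. by rewrite linearB. Qed.

Lemma mxtrace_trmxC n (A : 'M[C]_n) : \tr (A ^t*) = (\tr A)^*.
Proof. by rewrite -map_trmx mxtrace_tr trace_map_mx. Qed.

Lemma mxtrace_gram m n (A : 'M[C]_(m, n)) :
  \tr (A *m A ^t*) = \sum_i \sum_j `|A i j| ^+ 2.
Proof.
apply: eq_bigr => i _; rewrite mxE; apply: eq_bigr => j _.
by rewrite !mxE normCK.
Qed.

Lemma mxtrace_gram_ge0 m n (A : 'M[C]_(m, n)) : 0 <= \tr (A *m A ^t*).
Proof.
by rewrite mxtrace_gram; do 2![apply: sumr_ge0 => ? _]; rewrite exprn_ge0.
Qed.

Lemma mxtrace_gram_eq0 m n (A : 'M[C]_(m, n)) : \tr (A *m A ^t*) = 0 -> A = 0.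
Proof.
have ge0 i j : 0 <= `|A i j| ^+ 2 by rewrite exprn_ge0.
rewrite mxtrace_gram => A0; apply/matrixP => i j; rewrite mxE.
have /psumr_eq0P : \sum_j `|A i j| ^+ 2 = 0.
  by apply: (psumr_eq0P _ A0) => // k _; apply: sumr_ge0.
move=> /(_ (fun j _ => ge0 i j) j isT) /eqP.
by rewrite expf_eq0 /= normr_eq0 => /eqP.
Qed.

(** Serves to derive identities about [T] and [Q] when only the link [T *m T = Q *m Q ^t*] is
    known. *)
Lemma gram_eq0 m n (A : 'M[C]_(m, n)) : A *m A ^t* = 0 -> A = 0.
Proof. by move=> A0; apply: mxtrace_gram_eq0; rewrite A0 mxtrace0. Qed.

Lemma frobenius_sqr m n (A : 'M[C]_(m, n)) :
  frobenius A ^+ 2 = \tr (A *m A ^t*).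
Proof. by rewrite sqrtCK mxtrace_gram. Qed.

Lemma frobenius_ge0 m n (A : 'M[C]_(m, n)) : 0 <= frobenius A.
Proof. by rewrite sqrtC_ge0 -mxtrace_gram mxtrace_gram_ge0. Qed.

(** Each diagonal entry is the quadratic form of [T] at a column of [Y]. *)
Lemma mxtrace_psd_form_ge0 m n (T : 'M[C]_n) (Y : 'M[C]_(n, m)) :
  psdmx T -> 0 <= \tr (Y ^t* *m T *m Y).
Proof.
move=> [_ T0]; apply: sumr_ge0 => j _.
suff -> : (Y ^t* *m T *m Y) j j = ((col j Y) ^t* *m T *m col j Y) 0 0 by [].
rewrite tr_col map_row -row_mul [LHS]mxE [RHS]mxE.
by apply: eq_bigr => i _; rewrite !mxE.
Qed.

(** In a full-rank factorization Q = FG, the outer factors cancel from FGFG = FG, leaving GF = 1 of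
    size rank Q; then tr FG = tr GF. *)
Lemma mxtrace_idempotent (F : fieldType) n (Q : 'M[F]_n) :
  Q *m Q = Q -> \tr Q = (\rank Q)%:R.
Proof.
rewrite -{1 2 3}(mulmx_base Q) => FGFG.
have GF : row_base Q *m col_base Q = 1%:M.
  have freeF : row_free (col_base Q)^T.
    by rewrite -row_leq_rank mxrank_tr (eqP (col_base_full Q)).
  apply: (row_free_inj (row_base_free Q)); rewrite mul1mx.
  apply: trmx_inj; apply: (row_free_inj freeF).
  by rewrite -!trmx_mul !mulmxA in FGFG *; rewrite FGFG.
by rewrite -{1}(mulmx_base Q) mxtrace_mulC GF mxtrace1.
Qed.

End FrobeniusTrace.

(** * Algebra of the matched projection and the trace gap tr T - tr Q *)

Section MatchedProjection.
Local Open Scope sesquilinear_scope.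
Context {C : numClosedFieldType}.

Lemma penrose_trmxC m n (A : 'M[C]_(m, n)) (X : 'M[C]_(n, m)) :
  penrose A X -> penrose (A ^t*) (X ^t*).
Proof.
move=> [X1 X2 X3 X4]; split; rewrite -!trmxC_mul ?X3 ?X4 //.
  by rewrite mulmxA X1.
by rewrite mulmxA X2.
Qed.

(** The adjoint solves the Penrose equations of [T ^t*], which is [T], and their solution is
    unique. *)
Lemma mpinvmx_herm n (T : 'M[C]_n) : T ^t* = T -> (mpinvmx T) ^t* = mpinvmx T.
Proof.
move=> hT; apply: (@penrose_unique _ _ _ T); last exact: mpinvmxP.
by rewrite -{1}hT; apply: penrose_trmxC; exact: mpinvmxP.
Qed.

Lemma mpinvmx_comm n (T : 'M[C]_n) :
  T ^t* = T -> mpinvmx T *m T = T *m mpinvmx T.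
Proof.
move=> hT; have [_ _ X3 _] := mpinvmxP T.
by rewrite -X3 trmxC_mul hT mpinvmx_herm.
Qed.

Context {n : nat} (Q : 'M[C]_n) (hQ : is_idempotent Q).
Let T := absmx (Q ^t*).
Let E := T *m mpinvmx T.
Let K := mpinvmx T *m invmx (T + 1%:M).

Let hT : T ^t* = T. Proof. by have [[]] := absmxP (Q ^t*). Qed.

Let TT : T *m T = Q *m Q ^t*.
Proof. by have [_] := absmxP (Q ^t*); rewrite trmxCK. Qed.

Let T1_unit : T + 1%:M \in unitmx. Proof. exact: absmx_add1_unit. Qed.

Let hE : E ^t* = E. Proof. by have [] := mpinvmxP T. Qed.

Let ET : E *m T = T. Proof. by have [] := mpinvmxP T. Qed.

Let TE : T *m E = T. Proof. by rewrite /E -mpinvmx_comm // mulmxA ET. Qed.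

(** The Gram matrix of (Q - 1)T contains the factor (Q - 1)QQ*, which vanishes by idempotence. *)
Let QT : Q *m T = T.
Proof.
apply/eqP; rewrite -subr_eq0 -[X in _ - X]mul1mx -mulmxBl; apply/eqP/gram_eq0.
rewrite trmxC_mul hT mulmxA -(mulmxA _ T T) TT mulmxA mulmxBl hQ mul1mx subrr.
by rewrite !mul0mx.
Qed.

Let TQ : T *m Q ^t* = T. Proof. by rewrite -{1}hT -trmxC_mul QT. Qed.

(** Dually, the Gram matrix of (E - 1)Q contains (E - 1)TT = 0. *)
Let EQ : E *m Q = Q.
Proof.
apply/eqP; rewrite -subr_eq0 -[X in _ - X]mul1mx -mulmxBl; apply/eqP/gram_eq0.
rewrite trmxC_mul mulmxA -(mulmxA _ Q (Q ^t*)) -TT mulmxA mulmxBl ET mul1mx.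
by rewrite subrr !mul0mx.
Qed.

Let QE : Q *m E = E. Proof. by rewrite /E mulmxA QT. Qed.

Lemma mxtrace_range_projection : \tr E = \tr Q.
Proof. by rewrite -QE mxtrace_mulC EQ. Qed.

Let T1_comm : (T + 1%:M) *m mpinvmx T = mpinvmx T *m (T + 1%:M).
Proof. by rewrite mulmxDl mulmxDr mul1mx mulmx1 mpinvmx_comm. Qed.

Let K_comm : invmx (T + 1%:M) *m mpinvmx T = K.
Proof.
by rewrite /K -[in RHS](mulKmx T1_unit (mpinvmx T)) T1_comm mulmxA mulmxK.
Qed.

Let hK : K ^t* = K.
Proof. by rewrite trmxC_mul trmxC_invmx trmxCD trmxC1 mpinvmx_herm // hT. Qed.

Let TK : (T + T *m T) *m K = E.
Proof.
rewrite -[X in X + _]mulmx1 -mulmxDr addrC -K_comm.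
by rewrite mulmxA -(mulmxA T) mulmxV // mulmx1.
Qed.

Let matchedE :
  matched_projection Q = 2^-1 *: ((T + Q ^t*) *m K *m (T + Q)).
Proof. by rewrite /matched_projection /K !mulmxA. Qed.

Let gram_TQ : (T + Q) *m (T + Q ^t*) = 2 *: (T + T *m T).
Proof.
rewrite mulmxDl !mulmxDr TQ QT -TT scaler_nat mulr2n.
by rewrite [T *m T + T]addrC.
Qed.

Lemma mul_matched_projection : Q *m matched_projection Q = 2^-1 *: (T + Q).
Proof.
rewrite matchedE -scalemxAr mulmxA (mulmxA Q _ K) [Q *m (_ + _)]mulmxDr QT -TT.
by rewrite TK mulmxDr ET EQ.
Qed.

Lemma matched_projection_herm :
  (matched_projection Q) ^t* = matched_projection Q.
Proof.
rewrite matchedE linearZ /= map_mxZ trmxC_mul (trmxC_mul _ K) hK.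
rewrite !trmxCD trmxCK hT mulmxA.
by rewrite fmorphV rmorph_nat.
Qed.

Lemma mxtrace_matched_projection : \tr (matched_projection Q) = \tr Q.
Proof.
rewrite matchedE mxtraceZ mxtrace_mulC mulmxA gram_TQ -scalemxAl TK mxtraceZ.
by rewrite mulKf ?pnatr_eq0 // mxtrace_range_projection.
Qed.

Lemma matched_projection_idem : is_idempotent (matched_projection Q).
Proof.
have absorb : (T + Q) *m matched_projection Q = T + Q.
  rewrite matchedE -scalemxAr mulmxA (mulmxA (T + Q) _ K) gram_TQ -!scalemxAl.
  by rewrite scalerA mulVf ?pnatr_eq0 // scale1r TK mulmxDr ET EQ.
rewrite /is_idempotent {1}matchedE -scalemxAl -(mulmxA _ (T + Q)) absorb.
by rewrite -matchedE.
Qed.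

(** Both sides expand to T^2 - E. *)
Lemma range_projection_defect :
  (T + 1%:M) *m (T - E) = (Q - E) *m (Q - E) ^t*.
Proof.
rewrite trmxCB hE mulmxDl mul1mx !mulmxBr !mulmxBl QE -TT TE.
have -> : E *m Q ^t* = E by rewrite -{1}hE -trmxC_mul QE.
by rewrite /E mulmxA ET subrr subr0 addrA subrK.
Qed.

(** With N = Q - E = (T + 1)Y, the form N*(T + 1)^-1 N becomes Y*(T + 1)Y, which splits into two
    nonnegative traces. *)
Lemma mxtrace_absmx_sub :
  let Y := invmx (T + 1%:M) *m (Q - E) in
  \tr T - \tr Q = \tr (Y ^t* *m T *m Y) + \tr (Y ^t* *m Y).
Proof.
move=> Y; have TY : (T + 1%:M) *m Y = Q - E by rewrite mulKVmx.
rewrite -mxtrace_range_projection -mxtraceB.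
have -> : T - E = Y *m (Q - E) ^t*.
  by rewrite -(mulKmx T1_unit (T - E)) range_projection_defect mulmxA.
rewrite mxtrace_mulC -TY trmxC_mul trmxCD trmxC1 hT mulmxDr mulmx1 mulmxDl.
by rewrite mxtraceD.
Qed.

Lemma mxtrace_absmx_ge : 0 <= \tr T - \tr Q.
Proof.
rewrite mxtrace_absmx_sub addr_ge0 //.
  by apply: mxtrace_psd_form_ge0; have [] := absmxP (Q ^t*).
by rewrite mxtrace_mulC mxtrace_gram_ge0.
Qed.

Lemma mxtrace_absmx_eq : \tr T = \tr Q <-> is_projection Q.
Proof.
split=> [/eqP | [hermQ _]].
  rewrite -subr_eq0 mxtrace_absmx_sub; set Y := invmx _ *m (Q - E).
  rewrite paddr_eq0; first last.
  - by rewrite mxtrace_mulC mxtrace_gram_ge0.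
  - by apply: mxtrace_psd_form_ge0; have [] := absmxP (Q ^t*).
  rewrite [X in _ && (X == 0)]mxtrace_mulC.
  (* The Gram term alone forces Y = 0, hence Q = E, which is Hermitian. *)
  move=> /andP[_ /eqP /mxtrace_gram_eq0 Y0].
  have /eqP : Q - E = 0 by rewrite -(mulKVmx T1_unit (Q - E)) -/Y Y0 mulmx0.
  by rewrite subr_eq0 => /eqP QEE; split=> //; rewrite QEE hE.
(* For Hermitian Q, taking adjoints in QE = E gives EQ = E, while EQ = Q. *)
have QE0 : Q - E = 0.
  by apply/eqP; rewrite subr_eq0 -{1}EQ -hE -{1}hermQ -trmxC_mul QE.
have := range_projection_defect; rewrite QE0 mul0mx.
move=> /(congr1 (mulmx (invmx (T + 1%:M)))); rewrite mulKmx // mulmx0.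
by move=> /eqP; rewrite subr_eq0 => /eqP ->; rewrite mxtrace_range_projection.
Qed.

Lemma frobenius_matched_sub :
  frobenius (matched_projection Q - Q) ^+ 2 = \tr (Q *m Q ^t*) - \tr T.
Proof.
rewrite frobenius_sqr trmxCB matched_projection_herm.
set M := matched_projection Q.
have trQM : \tr (Q *m M) = 2^-1 * (\tr T + \tr Q).
  by rewrite mul_matched_projection mxtraceZ mxtraceD.
have trMQ : \tr (M *m Q ^t*) = 2^-1 * (\tr T + \tr Q).
  rewrite /M -matched_projection_herm -trmxC_mul mul_matched_projection.
  rewrite linearZ /= map_mxZ fmorphV rmorph_nat trmxCD hT mxtraceZ mxtraceD.
  (* The trace of Q is a natural number, so conjugation fixes it. *)
  by rewrite mxtrace_trmxC (mxtrace_idempotent _ _ Q hQ) rmorph_nat.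
rewrite mulmxBl !mulmxBr [M *m M]matched_projection_idem !mxtraceB.
rewrite mxtrace_matched_projection trQM trMQ; by field.
Qed.

(** By cyclicity both cross terms have trace rank Q, so the left side is rank P - 2 rank Q + tr QQ*;
    [frobenius_matched_sub] accounts for tr QQ*. *)
Lemma frobenius_sub_sqr (P : 'M[C]_n) :
  is_projection P -> P *m Q = Q ->
  frobenius (P - Q) ^+ 2 = frobenius (matched_projection Q - Q) ^+ 2
    + (\rank P)%:R - (\rank Q)%:R + (\tr T - \tr Q).
Proof.
move=> [hermP idemP] PQ; have QP : Q ^t* *m P = Q ^t*.
  by rewrite -{1}hermP -trmxC_mul PQ.
rewrite frobenius_matched_sub frobenius_sqr trmxCB hermP mulmxBl !mulmxBr.
rewrite idemP !mxtraceB [\tr (Q *m P)]mxtrace_mulC PQ.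
rewrite [\tr (P *m _)]mxtrace_mulC QP mxtrace_trmxC.
rewrite (mxtrace_idempotent _ _ P idemP) (mxtrace_idempotent _ _ Q hQ).
by rewrite rmorph_nat; ring.
Qed.

End MatchedProjection.

Theorem theorem5p1 (R : realType) (n : nat) (hn : (0 < n)%N)
    (P Q : 'M[R[i]]_n) (hP : is_projection P) (hQ : is_idempotent Q)
    (hPQ : P *m Q = Q) :
  lambda P Q <= frobenius (P - Q) /\
  (frobenius (P - Q) = lambda P Q <-> is_projection Q).
Proof.
have normPQ := frobenius_sub_sqr Q hQ P hP hPQ.
have gap_ge0 := mxtrace_absmx_ge Q hQ.
have gap_eq0 := mxtrace_absmx_eq Q hQ.
(* This makes the radicand of [lambda] nonnegative, so comparing norms reduces to comparing
   squares. *)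
have rankQP : ((\rank Q)%:R : R[i]) <= (\rank P)%:R.
  by rewrite ler_nat -hPQ mxrankM_maxl.
have lambda_sqr_ge0 : 0 <= frobenius (matched_projection Q - Q) ^+ 2
    + (\rank P)%:R - (\rank Q)%:R.
  by rewrite -addrA addr_ge0 ?subr_ge0 // exprn_ge0 ?frobenius_ge0.
have lambda_ge0 : 0 <= lambda P Q by rewrite sqrtC_ge0.
have lambdaK : lambda P Q ^+ 2 = _ := sqrtCK _.
rewrite -lambdaK in normPQ.
split; first by rewrite -(ler_pXn2r (n := 2)) ?nnegrE ?frobenius_ge0 //
  normPQ lerDl.
split=> [eqPQ | /gap_eq0 eqT].
  apply/gap_eq0/eqP; rewrite -subr_eq0; apply/eqP/(addrI (lambda P Q ^+ 2)).
  by rewrite -normPQ eqPQ addr0.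
apply/eqP; rewrite -(eqrXn2 (n := 2)) ?frobenius_ge0 //.
by rewrite normPQ eqT subrr addr0.
Qed.
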